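(* Let $n > k > t > j \geq 1$ be integers and let $\mathcal F \subset \binom{[n]}{k}$ be a $t$-intersecting family with $$|\mathcal F| \geq \binom{2k-t}{k}\left(1 + \frac{t-j}{k+t+1-j}\right).$$ Then $$\frac{|\partial^j \mathcal F|}{|\mathcal F|} \geq \frac{\binom{2(k-1)-t}{k-1-j}}{\binom{2(k-1)-t}{k-1}}.$$
   Context: $[n]=\{1,\dots,n\}$, and $\binom{[n]}{k}$ is the collection of all $k$-element subsets of $[n]$. A family $\mathcal F \subset \binom{[n]}{k}$ is $t$-intersecting if $|F\cap F'|\ge t$ for all $F,F'\in\mathcal F$. The $j$'th shadow is $\partial^j\mathcal F=\{G\in\binom{[n]}{k-j} : \exists F\in\mathcal F,\ G\subset F\}$. *)

(* Defs.v *)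
From mathcomp Require Import all_boot all_order all_algebra.

Set Implicit Arguments.
Unset Strict Implicit.
Unset Printing Implicit Defensive.

(* The ground set [n] is represented by 'I_n = {0, ..., n-1}. *)

Definition ksubsets (n k : nat) : {set {set 'I_n}} :=
  [set A : {set 'I_n} | #|A| == k].

(* A and B are not required to be distinct. *)
Definition t_intersecting (n t : nat) (F : {set {set 'I_n}}) : Prop :=
  forall A B : {set 'I_n}, A \in F -> B \in F -> t <= #|A :&: B|.

(* The j-th shadow of a family of k-subsets; k is an explicit parameter since
   it cannot be read off from an empty F.  Intended for j <= k, where k - j is
   not truncated. *)
Definition shadow (n k j : nat) (F : {set {set 'I_n}}) : {set {set 'I_n}} :=
  [set G in ksubsets n (k - j) | [exists A in F, G \subset A]].

(* Main.v *)
Require Import Defs.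
From mathcomp Require Import all_boot all_order all_algebra.
From mathcomp Require Import perm zify ring lra.
Import Order.TTheory GRing.Theory Num.Theory.

(* Shifting reduces to the case where F is shifted.  View a set A as the lattice
   path whose height after N steps is 2 |A cap [N]| - N, and let w = 2k - t.  If
   every path in F reaches height t before time w, then cutting each path at its
   last visit to height t and applying the local LYM inequality to the initial
   segments gives the bound.  Otherwise some path does not reach height t before
   time w, and shiftedness together with t-intersection forces every member of F
   not contained in [w] to reach height t + 1; cutting at the last visit to
   height t + 1, or t + 2 if possible, yields for these members a shadow larger
   than required.  This surplus compensates the deficit of the at most C(w, k)
   members contained in [w].  If some member outside [w] misses height t + 2, the
   surplus is smaller, but then F contains no set P cup {w-1, w} where P is a
   (k-2)-subset of [w-2] whose path stays below height t - 1, and these sets are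
   counted by reflection. *)

Set Implicit Arguments.
Unset Strict Implicit.
Unset Printing Implicit Defensive.

(** * Local LYM inequalities, on one set and along a line *)

(** Count pairs of [A] in [F] and a [j]-subset [J] of [A :&: Y]. The map to [(A :\: J, J)] is
    injective, and [A :\: J] keeps at least [a - j] points of [Y], which leaves at most [y - a + j]
    points for [J]. *)
Lemma local_lym (T : finType) (F G : {set {set T}}) (Y : {set T}) a y j :
  #|Y| <= y -> j <= a ->
  (forall A, A \in F -> a <= #|A :&: Y|) ->
  (forall A J : {set _}, A \in F -> J \subset A :&: Y -> #|J| = j ->
     A :\: J \in G) ->
  #|F| * 'C(a, j) <= #|G| * 'C(y - a + j, j).
Proof.
move=> leYy leja hF hG.
pose S := [set p : {set T} * {set T} |
  (p.1 \in F) && ((p.2 \subset p.1 :&: Y) && (#|p.2| == j))].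
pose S' := [set p : {set T} * {set T} |
  ((p.1 \in G) && (a - j <= #|p.1 :&: Y|)) &&
  ((p.2 \subset Y :\: p.1) && (#|p.2| == j))].
have geS : #|F| * 'C(a, j) <= #|S|.
  have -> : #|S| = \sum_(A in F)
      \sum_(J : {set T} | (J \subset A :&: Y) && (#|J| == j)) 1.
    by rewrite pair_big_dep -sum1_card; apply: eq_bigl => p; rewrite inE.
  rewrite -sum_nat_const; apply: leq_sum => A AF.
  by rewrite sum1dep_card cards_draws leq_bin2l // hF.
have leS' : #|S'| <= #|G| * 'C(y - a + j, j).
  have -> : #|S'| = \sum_(H in G | a - j <= #|H :&: Y|)
      \sum_(J : {set T} | (J \subset Y :\: H) && (#|J| == j)) 1.
    by rewrite pair_big_dep -sum1_card; apply: eq_bigl => p; rewrite inE.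
  rewrite -sum_nat_const big_mkcondr /=; apply: leq_sum => H HG.
  case: ifP => // aH; rewrite sum1dep_card cards_draws leq_bin2l //.
  by rewrite cardsD setIC; lia.
apply: leq_trans geS (leq_trans _ leS').
pose f (p : {set T} * {set T}) := (p.1 :\: p.2, p.2).
have injf : {in S &, injective f}.
  move=> [A J] [A' J']; rewrite !inE /= => /and3P[_ sJ _] /and3P[_ sJ' _].
  case=> eqD eqJ; subst J'; congr (_, _).
  rewrite subsetI in sJ; rewrite subsetI in sJ'.
  case/andP: sJ => /setIidPr eA _; case/andP: sJ' => /setIidPr eA' _.
  by rewrite -(setID A J) -(setID A' J) eA eA' eqD.
rewrite -(card_in_imset injf); apply/subset_leq_card/subsetP => q.
case/imsetP=> -[A J]; rewrite inE /= => /and3P[AF sJ /eqP cJ] ->.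
rewrite inE /= hG // cJ eqxx andbT /=; apply/andP; split.
  rewrite setIDAC cardsDS // cJ leq_sub2r //; exact: hF.
rewrite subsetD (subset_trans sJ (subsetIr _ _)) /=.
by rewrite disjoint_sym disjoints_subset setDE subsetIr.
Qed.

Definition init n N : {set 'I_n} := [set x : 'I_n | x < N].

Lemma card_init n N : #|init n N| <= N.
Proof.
elim: N => [|N IH].
  by rewrite (_ : init n 0 = set0) ?cards0 //; apply/setP=> x; rewrite !inE.
have [ltNn|leNn] := ltnP N n.
  rewrite (_ : init n N.+1 = Ordinal ltNn |: init n N).
    by rewrite cardsU1 -add1n leq_add ?leq_b1.
  by apply/setP => x; rewrite !inE ltnS leq_eqVlt -val_eqE.
by apply: leq_trans (max_card _) _; rewrite card_ord; lia.
Qed.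

Lemma init_subset n N M : N <= M -> init n N \subset init n M.
Proof. by move=> leNM; apply/subsetP => x; rewrite !inE; lia. Qed.

(** The ratio of ['C(L + j, j)] to ['C(L + c, j)] does not decrease with [L]: once common factors
    are cancelled, the two sides differ by [(c - j) * j]. *)
Lemma bin_ratio_mono c L j : j <= c ->
  'C(L + c.+1, j) * 'C(L + j, j) <= 'C(L + c, j) * 'C(L.+1 + j, j).
Proof.
move=> lejc.
have h1 := mul_bin_down (L + c.+1) j; have h2 := mul_bin_down (L.+1 + j) j.
move: h1 h2; rewrite addnS addSn /= => h1 h2.
have p1 : 0 < (L + c).+1 - j by lia.
have p2 : 0 < (L + j).+1 - j by lia.
rewrite -(leq_pmul2l p1) -(leq_pmul2l p2).
move: h1 h2 p1 p2.
set a := 'C((L + c).+1, j); set b := 'C(L + j, j); set d := 'C(L + c, j).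
set e := 'C((L + j).+1, j) => h1 h2 p1 p2.
rewrite (_ : _ * (_ * (a * b)) = ((L + j).+1 - j) * b * (((L + c).+1 - j) * a));
  last by ring.
rewrite (_ : _ * (_ * (d * e)) = ((L + c).+1 - j) * d * (((L + j).+1 - j) * e));
  last by ring.
rewrite -h1 -h2 (_ : _ * b * _ = d * b * (((L + j).+1 - j) * (L + c).+1));
  last by ring.
rewrite (_ : _ * d * _ = d * b * (((L + c).+1 - j) * (L + j).+1)); last by ring.
rewrite leq_mul2l; apply/orP; right.
rewrite (_ : (L + j).+1 - j = L.+1); last by lia.
rewrite (_ : (L + c).+1 - j = L.+1 + (c - j)); last by lia.
have [i ->] : exists i, c = i + j by exists (c - j); lia.
rewrite addnK; apply: (leq_trans (leq_addr (i * j) _)); apply: eq_leq; ring.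
Qed.

(* If A misses the line at index L, then A :\: J misses the line lowered by j
   there, so the subsets obtained from the sets meeting it at L and from the
   others are disjoint; iterating, each A is cut at its last visit. *)
Lemma line_lym n (F G : {set {set 'I_n}}) c L j : j <= c ->
  (forall A, A \in F ->
     exists2 i, i <= L & i + c <= #|A :&: init n (2 * i + c)|) ->
  (forall A J : {set _}, A \in F -> J \subset A :&: init n (2 * L + c) ->
     #|J| = j -> A :\: J \in G) ->
  #|F| * 'C(L + c, j) <= #|G| * 'C(L + j, j).
Proof.
move=> lejc; elim: L F G => [|L IH] F G hF hG.
  have := @local_lym _ F G (init n (2 * 0 + c)) (0 + c) c j.
  rewrite subnn; apply => //; first exact: card_init.
  by move=> A /hF [i]; rewrite leqn0 => /eqP ->.
pose Y := init n (2 * L.+1 + c).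
pose F1 := [set A in F | L.+1 + c <= #|A :&: Y|].
pose G1 := [set H in G | L.+1 + c - j <= #|H :&: Y|].
have cardJ (A J : {set 'I_n}) : J \subset A :&: Y -> #|J| = j ->
  #|(A :\: J) :&: Y| = #|A :&: Y| - j.
  by move=> sJ cJ; rewrite setIDAC cardsDS // cJ.
have top : #|F1| * 'C(L.+1 + c, j) <= #|G1| * 'C(L.+1 + j, j).
  have -> : L.+1 + j = (2 * L.+1 + c) - (L.+1 + c) + j by lia.
  apply: (@local_lym _ F1 G1 Y); [exact: card_init | by lia | |].
    by move=> A; rewrite inE => /andP[].
  move=> A J; rewrite inE => /andP[AF cA] sJ cJ.
  by rewrite inE hG //= cardJ // leq_sub2r.
have low : #|F :\: F1| * 'C(L + c, j) <= #|G :\: G1| * 'C(L + j, j).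
  apply: IH => [A|A J].
    rewrite !inE => /andP[nA AF]; case: (hF A AF) => i; rewrite leq_eqVlt.
    case/orP=> [/eqP ->|]; last by exists i.
    by rewrite AF /= in nA; rewrite /Y in nA; rewrite (negPf nA).
  rewrite !inE => /andP[nA AF] sJ cJ; rewrite AF /= in nA.
  have sJY : J \subset A :&: Y.
    by apply: subset_trans sJ (setIS _ (init_subset _ _)); lia.
  rewrite hG // andbT /= cardJ // -ltnNge.
  have : j <= #|A :&: Y| by rewrite -cJ subset_leq_card.
by move: nA; rewrite -ltnNge => ltA jA; rewrite ltn_sub2rE.
(* The bound obtained at index [L] is at least as strong as the one needed at [L.+1]. *)
have mono : #|F :\: F1| * 'C(L.+1 + c, j) <= #|G :\: G1| * 'C(L.+1 + j, j).
  have pos : 0 < 'C(L + c, j) by rewrite bin_gt0; lia.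
  have h := bin_ratio_mono L lejc; rewrite addnS -addSn in h.
  have pos' : 0 < 'C(L + j, j) by rewrite bin_gt0; lia.
  move: low h pos pos'.
  set x := #|_|; set y := #|_|; set p := 'C(_, _); set q := 'C(_, _).
  set r := 'C(_, _); set s := 'C(_, _) => low h pp qq.
  rewrite -(leq_pmul2r pp) -(leq_pmul2r qq).
  apply: (@leq_trans ((x * p) * (r * q))); first by apply: eq_leq; ring.
  apply: leq_trans (leq_mul low h) _; apply: eq_leq; ring.
have cF : #|F| = #|F1| + #|F :\: F1|.
  rewrite -(cardsID F1 F); congr (#|pred_of_set _| + _).
  by apply/setP => A; rewrite !inE; case: (A \in F).
have cG : #|G| = #|G1| + #|G :\: G1|.
  rewrite -(cardsID G1 G); congr (#|pred_of_set _| + _).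
  by apply/setP => A; rewrite !inE; case: (A \in G).
by rewrite cF cG !mulnDl leq_add.
Qed.

(** * Shifting *)

Section Shift.
Variables (n : nat) (x y : 'I_n).
Implicit Types (A B H K : {set 'I_n}) (F : {set {set 'I_n}}).

(** As a preimage under a transposition, [swap] is an involution that commutes with intersection; it
    replaces [y] by [x] on sets that contain [y] but not [x]. *)
Definition swap (A : {set 'I_n}) : {set 'I_n} := tperm x y @^-1: A.

Definition movable (F : {set {set 'I_n}}) (A : {set 'I_n}) :=
  [&& y \in A, x \notin A & swap A \notin F].

Definition shift1 (F : {set {set 'I_n}}) (A : {set 'I_n}) :=
  if movable F A then swap A else A.

Definition shift (F : {set {set 'I_n}}) := shift1 F @: F.

Lemma swapK : involutive swap.
Proof. by move=> A; apply/setP => z; rewrite !inE tpermK. Qed.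

Lemma card_swap A : #|swap A| = #|A|.
Proof. exact/card_preimset/perm_inj. Qed.

Lemma swapI A B : swap (A :&: B) = swap A :&: swap B.
Proof. exact: preimsetI. Qed.

Lemma swapS A B : A \subset B -> swap A \subset swap B.
Proof. exact: preimsetS. Qed.

Lemma in_swapl A : (x \in swap A) = (y \in A).
Proof. by rewrite inE tpermL. Qed.

Lemma in_swapr A : (y \in swap A) = (x \in A).
Proof. by rewrite inE tpermR. Qed.

Lemma swap_id A : (x \in A) = (y \in A) -> swap A = A.
Proof.
move=> exy; apply/setP => z; rewrite inE.
by case: tpermP => [->|->|].
Qed.

Lemma shift1_inj F : {in F &, injective (shift1 F)}.
Proof.
move=> A B AF BF; rewrite /shift1 /movable.
case: ifP => [/and3P[_ _ nA]|_]; case: ifP => [/and3P[_ _ nB]|_] //.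
- exact: (can_inj swapK).
- by move=> e; rewrite e BF in nA.
- by move=> e; rewrite -e AF in nB.
Qed.

Lemma card_shift F : #|shift F| = #|F|.
Proof. exact/card_in_imset/shift1_inj. Qed.

Lemma shift_ksubsets k F :
  F \subset ksubsets n k -> shift F \subset ksubsets n k.
Proof.
move=> /subsetP hF; apply/subsetP => _ /imsetP[A /hF hA ->].
by rewrite /shift1 !inE in hA *; case: ifP => // _; rewrite card_swap.
Qed.

(** The critical case is that [A] moves and [B] stays. Then [y] is not in [B] and no common point is
    lost, or [B] is invariant under [swap], or [swap B] is in [F] and meets [A] in as many points as
    [swap A] meets [B]. *)
Lemma shift_t_intersecting t F :
  t_intersecting t F -> t_intersecting t (shift F).
Proof.
move=> hF.
have aux A B : A \in F -> B \in F -> movable F A -> ~~ movable F B ->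
  t <= #|swap A :&: B|.
  move=> AF BF /and3P[yA xA sA]; rewrite /movable.
  case yB: (y \in B) => /=; last first.
    move=> _; apply: leq_trans (hF A B AF BF) (subset_leq_card _).
    apply/subsetP => z; rewrite !inE => /andP[zA zB].
    rewrite zB andbT; case: tpermP => [e|e|//]; last by rewrite -e zB in yB.
    by rewrite -e zA in xA.
  case xB: (x \in B) => /=.
    by rewrite -[B]swap_id ?xB ?yB // -swapI card_swap => _; apply: hF.
  rewrite negbK => sB; rewrite -[B]swapK -swapI card_swap; exact: hF.
move=> _ _ /imsetP[A AF ->] /imsetP[B BF ->]; rewrite /shift1.
case mA: (movable F A); case mB: (movable F B).
- by rewrite -swapI card_swap; apply: hF.
- by apply: aux => //; rewrite mB.
- by rewrite setIC; apply: aux => //; rewrite mA.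
- exact: hF.
Qed.

(** A subset [H] of a moved set avoids [y], and [swap H] is in the old shadow; so [H] is an old
    element that stays, or the image of [swap H]. A subset of an unmoved set is an old element, and
    if it could move, its swap would already be in the shadow. *)
Lemma shadow_shift k j F : shadow k j (shift F) \subset shift (shadow k j F).
Proof.
apply/subsetP => H; rewrite !inE => /andP[cH /exists_inP[_ /imsetP[A AF ->]]].
have shE K : (K \in shadow k j F) = (#|K| == k - j) && [exists B in F, K \subset B].
  by rewrite !inE.
rewrite /shift1; case mA: (movable F A) => sH.
  case/and3P: mA => yA xA sA.
  have yH : y \notin H.
    by apply/negP => /(subsetP sH); rewrite in_swapr (negPf xA).
  have sHin : swap H \in shadow k j F.
    rewrite shE card_swap cH; apply/exists_inP; exists A => //.
    by rewrite -[A]swapK swapS.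
  case HF: (H \in shadow k j F).
    by apply/imsetP; exists H => //; rewrite /shift1 /movable (negPf yH).
  apply/imsetP; exists (swap H) => //.
  have xH : x \in H.
    apply/negPn/negP => xH; move: sHin; rewrite swap_id ?HF //.
    by rewrite (negPf xH) (negPf yH).
  by rewrite /shift1 /movable in_swapl in_swapr xH yH swapK HF.
have HF : H \in shadow k j F.
  by rewrite shE cH; apply/exists_inP; exists A.
apply/imsetP; exists H => //; rewrite /shift1; case: ifP => // /and3P[yH xH].
rewrite shE card_swap cH /= => /exists_inP[].
move/negbT: mA; rewrite /movable (subsetP sH _ yH) /= negb_and !negbK.
case/orP => hA; last by exists (swap A) => //; apply: swapS.
by exists A => //; rewrite -[A]swap_id ?swapS // hA (subsetP sH _ yH).
Qed.

End Shift.

Definition weight n (A : {set 'I_n}) : nat := \sum_(z in A) z.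

Lemma swapE n (x y : 'I_n) (A : {set 'I_n}) :
  y \in A -> x \notin A -> swap x y A = x |: A :\ y.
Proof.
move=> yA xA; apply/setP => z; rewrite !inE.
case: tpermP => [->|->|/eqP /negPf -> /eqP /negPf -> //].
  by rewrite eqxx yA.
by rewrite eqxx (negPf xA) /=; case: eqP => // e; rewrite -e yA in xA.
Qed.

Lemma weight_swap n (x y : 'I_n) (A : {set 'I_n}) :
  y \in A -> x \notin A -> weight (swap x y A) + y = weight A + x.
Proof.
move=> yA xA; rewrite swapE // /weight big_setU1 ?inE /=; last first.
  by rewrite (negPf xA) andbF.
by rewrite (big_setD1 y yA) /= addnC addnA addnAC.
Qed.

Definition shifted n (F : {set {set 'I_n}}) :=
  forall (x y : 'I_n) (A : {set 'I_n}), x < y -> A \in F -> y \in A -> x \notin A ->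
    x |: A :\ y \in F.

(** Every effective shift with [x < y] lowers the total weight, so repeated shifting terminates. *)
Lemma exists_shifted n k t j (F : {set {set 'I_n}}) :
  F \subset ksubsets n k -> t_intersecting t F ->
  exists F' : {set {set 'I_n}}, [/\ F' \subset ksubsets n k, t_intersecting t F',
    shifted F', #|F'| = #|F| & #|shadow k j F'| <= #|shadow k j F|].
Proof.
move: {2}(\sum_(A in F) weight A).+1 (ltnSn (\sum_(A in F) weight A)) => w.
elim: w F => // w IH F ltw hk ht.
have [/existsP[x /existsP[y /exists_inP[A AF]]] | stop] :=
  boolP [exists x : 'I_n, exists y : 'I_n, exists A in F, (x < y) && movable x y F A].
  case/andP => xy mA.
  have [|F' [h1 h2 h3 h4 h5]] := IH (shift x y F) _ (shift_ksubsets _ _ hk)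
      (shift_t_intersecting ht).
    rewrite -ltnS; apply: leq_trans ltw; rewrite ltnS big_imset /=; last first.
      exact: shift1_inj.
    have le B : B \in F -> weight (shift1 x y F B) <= weight B.
      rewrite /shift1; case: ifP => // /and3P[yB xB _] _.
      have := weight_swap yB xB; lia.
    rewrite (bigD1 A) //= [X in _ < X](bigD1 A) //= -addSn leq_add //.
      rewrite /shift1 mA; case/and3P: mA => yA xA _.
      have := weight_swap yA xA; lia.
    by apply: leq_sum => B /andP[/le].
  exists F'; split=> //; first by rewrite h4 card_shift.
  apply: leq_trans h5 (leq_trans (subset_leq_card (shadow_shift _ _ _ _ _)) _).
  by rewrite card_shift.
exists F; split=> // x y A xy AF yA xA; apply/negPn/negP => nin.
case/existsP: stop; exists x; apply/existsP; exists y; apply/exists_inP.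
by exists A; rewrite // xy /movable yA xA swapE.
Qed.

(* Cardinals of the same set may carry different but convertible finType
   instances; generalizing them identifies them for [lia]. *)
Ltac card_lia := clear; do ?[let c := fresh in move: #|_| => c]; lia.

(** * Prefixes of sets in a shifted intersecting family *)

Lemma card_setI_init n (A : {set 'I_n}) N : #|A :&: init n N| <= N.
Proof. exact: leq_trans (subset_leq_card (subsetIr _ _)) (card_init _ _). Qed.

Lemma setI_init_id n (A : {set 'I_n}) N : n <= N -> A :&: init n N = A.
Proof.
move=> leN; apply/setIidPl/subsetP => z _.
by rewrite inE (leq_trans (ltn_ord z)).
Qed.

Lemma initS n (x : 'I_n) : init n x.+1 = x |: init n x.
Proof. by apply/setP => z; rewrite !inE ltnS leq_eqVlt -val_eqE. Qed.

Lemma card_init_eq n N : N <= n -> #|init n N| = N.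
Proof.
elim: N => [_|N IH ltN].
  by apply/eqP; rewrite -leqn0 card_init.
rewrite -[X in init _ X.+1]/(nat_of_ord (Ordinal ltN)) initS cardsU1 !inE /= ltnn.
by rewrite IH // ltnW.
Qed.

Lemma card_setI_init_notin n (A : {set 'I_n}) (w : 'I_n) N :
  w < N -> w \notin A -> #|A :&: init n N| < N.
Proof.
move=> ltw wA; apply: leq_trans (card_init n N).
rewrite (cardsD1 w (init n N)) inE ltw ltnS; apply/subset_leq_card/subsetP => z.
rewrite !inE => /andP[zA ->]; rewrite andbT.
by apply: contraNneq wA => <-.
Qed.

(* Otherwise let z be the t-th common element of A and B.  Some w < z lies in
   neither set, and replacing z by w in A preserves the negated conclusion while
   decreasing #|A :&: B|, which eventually drops below t. *)
Lemma shifted_intersecting_prefix n t (F : {set {set 'I_n}}) (A B : {set 'I_n}) :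
  t_intersecting t F -> shifted F -> A \in F -> B \in F ->
  exists N, N + t <= #|A :&: init n N| + #|B :&: init n N|.
Proof.
move=> ht hs AF BF.
suff H : ~ (forall N, #|A :&: init n N| + #|B :&: init n N| < N + t).
  have [/existsP[N hN] | /existsPn H'] := boolP [exists N : 'I_n.+1,
      N + t <= #|A :&: init n N| + #|B :&: init n N|]; first by exists N.
  case: H => N; have [ltN|leN] := ltnP N n.+1.
    by rewrite ltnNge; exact: (H' (Ordinal ltN)).
  have := H' (Ordinal (ltnSn n)); rewrite /= -ltnNge !setI_init_id //; lia.
move: {2}#|A :&: B| (leqnn #|A :&: B|) => c.
elim: c A AF => [|c IH] A AF lec small.
  have := ht _ _ AF BF; have := small 0; lia.
have ex : exists N, t <= #|(A :&: B) :&: init n N|.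
  by exists n; rewrite setI_init_id //; exact: ht.
case: (ex_minnP ex) => -[|N] hN minN.
  by have := small 0; have := card_setI_init (A :&: B) 0; lia.
have UI M : #|A :&: init n M| + #|B :&: init n M| =
    #|(A :|: B) :&: init n M| + #|(A :&: B) :&: init n M|.
  rewrite -cardsUI -setIUl; congr (_ + #|pred_of_set _|).
  by apply/setP => u; rewrite !inE; case: (u < M); rewrite ?andbF ?andbT.
have ltN : #|(A :&: B) :&: init n N| < t.
  by rewrite ltnNge; apply/negP => /minN; rewrite ltnn.
have ltNn : N < n.
  rewrite ltnNge; apply/negP => leN.
  by move: ltN hN; rewrite !setI_init_id ?(leqW leN) //; lia.
pose z := Ordinal ltNn.
have zAB : z \in A :&: B.
  apply/negPn/negP => nz; move: hN; rewrite leqNgt; case/negP.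
  rewrite (_ : (A :&: B) :&: init n N.+1 = (A :&: B) :&: init n N) //.
  rewrite (initS z) setIUr (_ : A :&: B :&: [set z] = set0) ?set0U //.
  by apply/eqP; rewrite setI_eq0 disjoint_sym disjoints1.
have [zA zB] : z \in A /\ z \in B by move: zAB; rewrite inE => /andP.
(* If [A :|: B] filled the prefix of length [N.+1], which has at least [t] common points, the two
   counts would add up to at least [N.+1 + t]. *)
have [w [ltw wA wB]] : exists w : 'I_n, [/\ w < N, w \notin A & w \notin B].
  have [/existsP[w /and3P[h1 h2 h3]]|/existsPn no] :=
    boolP [exists w : 'I_n, [&& w < N.+1, w \notin A & w \notin B]].
    exists w; split=> //; move: h1; rewrite ltnS leq_eqVlt => /orP[/eqP e|//].
    by move: h2; rewrite (_ : w = z) ?zA //; apply: val_inj.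
  have full : (A :|: B) :&: init n N.+1 = init n N.+1.
    apply/setIidPr/subsetP => w; rewrite !inE => ltw.
    by have := no w; rewrite ltw /= -negb_or negbK.
  have := small N.+1; rewrite UI full card_init_eq //; lia.
apply: (IH (w |: A :\ z)); first exact: hs.
  have e := cardsD1 z (A :&: B); rewrite zAB add1n in e.
  suff -> : (w |: A :\ z) :&: B = (A :&: B) :\ z by move: lec; rewrite e.
  apply/setP => u; rewrite !inE; case: eqP => [->|_]; first by rewrite (negPf wB) !andbF.
  by rewrite andbA.
(* Only prefixes that contain [w] but not [z] gain a point. There [A :|: B] misses [w] and fewer
   than [t] points are common, so one more point is affordable. *)
move=> M; have sM := small M.
have leU : #|(w |: A :\ z) :&: init n M| <= (w < M) + #|(A :\ z) :&: init n M|.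
  have [ltwM|leMw] := ltnP w M.
    apply: leq_trans (_ : #|w |: (A :\ z) :&: init n M| <= _).
      apply/subset_leq_card/subsetP => u; rewrite !inE.
      by case: (u == w) => //=; case: (u < M); rewrite ?andbF.
    by rewrite cardsU1 leq_add2r leq_b1.
  apply/subset_leq_card/subsetP => u; rewrite !inE.
  by case: (altP (u =P w)) => [->|//]; rewrite ltnNge leMw andbF.
have zD : #|A :&: init n M| = (z < M) + #|(A :\ z) :&: init n M|.
  rewrite (cardsD1 z (A :&: init n M)) !inE zA /=.
  by rewrite setIDAC.
have [leMN|ltNM] := leqP M N; last first.
  have zM : z < M := ltNM.
  by move: leU zD sM; rewrite zM; case: (w < M) => /=; card_lia.
have [ltwM|leMw] := ltnP w M; last first.
  by move: leU zD sM; rewrite ltnNge leMw /=; card_lia.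
have := UI M; have : #|(A :|: B) :&: init n M| < M.
  by apply: (card_setI_init_notin ltwM); rewrite inE negb_or wA.
have : #|(A :&: B) :&: init n M| <= #|(A :&: B) :&: init n N|.
  exact/subset_leq_card/setIS/init_subset.
by move: leU zD sM ltN leMN; rewrite ltwM; card_lia.
Qed.

(** * Lattice paths and reflection *)

Definition hits n h m (P : {set 'I_n}) :=
  [exists N : 'I_m.+1, N + h <= 2 * #|P :&: init n N|].

(* Reflection principle: reflecting the path after its first visit to height h
   turns its number of up-steps from a into b. *)
Lemma card_hits n h m a b : m <= n -> a + b = m + h -> a <= b ->
  #|[set P : {set 'I_n} | [&& P \subset init n m, #|P| == a & hits h m P]]|
    <= 'C(m, b).
Proof.
have trivial m' a' : #|[set P : {set 'I_n} |
    [&& P \subset init n m', #|P| == a' & hits h m' P]]| <= 'C(m', a').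
  apply: (@leq_trans #|[set P : {set 'I_n} | P \subset init n m' & #|P| == a']|).
    by apply/subset_leq_card/subsetP => P; rewrite !inE => /and3P[-> ->].
  by rewrite cards_draws leq_bin2l // card_init.
elim: m a b => [|m IH] a b ltmn eab leab.
  case: (ltngtP a b) leab => // [ltab|->] _; last exact: trivial.
  rewrite (_ : [set _ | _] = set0) ?cards0 //; apply/setP => P; rewrite !inE.
  apply/negP => /and3P[sP /eqP cP /existsP[N]].
  have := subset_leq_card sP; have := card_init n 0.
  have := subset_leq_card (subsetIl P (init n N)).
  by move: cP eab ltab; card_lia.
case: (ltngtP a b) leab => // [ltab|->] _; last exact: trivial.
have ltm : m < n := ltmn.
pose x := Ordinal ltm.
case: b ltab eab => // b ltab eab.
pose X m a := [set P : {set 'I_n} | [&& P \subset init n m, #|P| == a & hits h m P]].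
(* Split by whether the last point [x] is in [P]. Since [a < b], height [h] is reached before the
   last step, so both parts inherit the visit, and Pascal's rule adds the bounds. The set
   [[set P | 0 < a]] removes the second part where [a.-1] is truncated. *)
have sub : X m.+1 a \subset X m a :|: (setU [set x] @: X m a.-1) :&: [set P | 0 < a].
  apply/subsetP => P; rewrite inE => /and3P[sP /eqP cP /existsP[[N ltN] /= hN]].
  have {ltN} leN : N < m.+1.
    move: ltN; rewrite ltnS leq_eqVlt => /orP[/eqP eN|//].
    have := subset_leq_card (subsetIl P (init n N)).
    by move: cP eab ltab hN eN; card_lia.
  have [xP|xP] := boolP (x \in P).
    have sP' : P :\ x \subset init n m.
      apply/subsetP => z; rewrite 2!inE => /andP[zx /(subsetP sP)].
      by rewrite (initS x) in_setU1 (negPf zx).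
    have cP' : #|P| = (#|P :\ x|).+1 by rewrite (cardsD1 x P) xP.
    rewrite !inE; apply/orP; right; rewrite -{2}cP cP' andbT.
    apply/imsetP; exists (P :\ x); last by rewrite setD1K.
    rewrite inE sP' -cP cP' eqxx /=; apply/existsP; exists (Ordinal leN) => /=.
    rewrite setIDAC (_ : _ :\ x = P :&: init n N) //; apply/setDidPl.
    by rewrite disjoint_sym disjoints1 !inE /= negb_and -leqNgt; lia.
  rewrite 2!inE cP eqxx; apply/orP; left; apply/andP; split.
    apply/subsetP => z zP; move/(_ z zP): (subsetP sP).
    by rewrite (initS x) in_setU1 => /orP[/eqP e|//]; rewrite -e zP in xP.
  by apply/existsP; exists (Ordinal leN).
apply: leq_trans (subset_leq_card sub) _; rewrite binS addnC.
apply: leq_trans (leq_card_setU _ _) _; apply: leq_add.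
  by apply: IH; lia.
case: a ltab eab sub => [|a] ltab eab _.
  by rewrite (_ : [set P | _] = set0) ?setI0 ?cards0 //; apply/setP => P; rewrite !inE.
apply: leq_trans (subset_leq_card (subsetIl _ _)) _.
apply: leq_trans (leq_imset_card _ _) _; rewrite /=.
by apply: IH; lia.
Qed.

Lemma card_setI_initS n (A : {set 'I_n}) N :
  #|A :&: init n N.+1| <= #|A :&: init n N|.+1.
Proof.
have [ltN|leN] := ltnP N n; last by rewrite !setI_init_id ?(leqW leN).
rewrite (initS (Ordinal ltN)) setIUr -add1n.
apply: leq_trans (leq_card_setU _ _) _; rewrite leq_add2r -(cards1 (Ordinal ltN)).
exact/subset_leq_card/subsetIr.
Qed.

(** Heights at times [2 * i + c] have the parity of [c], so below [c] there means at most [c - 2],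
    and one more step stays below [c]. Before time [c] the height is at most the time. *)
Lemma prefix_bound n (A : {set 'I_n}) c L : 0 < c ->
  (forall i, i < L -> #|A :&: init n (2 * i + c)| < i + c) ->
  forall N, N < 2 * L + c -> 2 * #|A :&: init n N| < N + c.
Proof.
move=> c0 hA N ltN; have [ltNc|leNc] := ltnP N c.
  by move: (card_setI_init A N) ltNc; card_lia.
have eN : N = odd (N - c) + (2 * (N - c)./2 + c).
  by have := odd_double_half (N - c); lia.
have ltL : (N - c)./2 < L by lia.
move: eN (hA _ ltL); set i := (N - c)./2; case: (odd _) => -> hi.
  by move: (card_setI_initS A (2 * i + c)) hi; rewrite add1n; card_lia.
by move: hi; rewrite add0n; card_lia.
Qed.

(** * Splitting the family by how far its sets reach *)

Lemma card_split3 (T : finType) (F : {set {set T}}) (Y Z : {set T}) :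
  Y \subset Z ->
  #|F| = #|[set A : {set T} in F | A \subset Y]| +
         #|[set A : {set T} in F | (A \subset Z) && ~~ (A \subset Y)]| +
         #|[set A : {set T} in F | ~~ (A \subset Z)]|.
Proof.
move=> sYZ; rewrite -(cardsID [set A : {set T} | A \subset Z] F).
rewrite -(cardsID [set A : {set T} | A \subset Y] (F :&: _)).
congr (_ + _ + _); apply: eq_card => A; rewrite !inE.
- case: (A \in F) => //=; case sY: (A \subset Y); rewrite ?andbF ?andbT //.
  by rewrite (subset_trans sY).
- by case: (A \in F); rewrite ?andbF //= andbC.
- by rewrite andbC.
Qed.

(** Both sides count pairs of an [(a - j)]-set inside an [a]-set among [a + b] points. This rewrites
    the ratio of the theorem as ['C(k.-1, j)] over ['C(u.-1 + j, j)]. *)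
Lemma bin_subset_swap a b j : j <= a ->
  'C(a + b, a) * 'C(a, j) = 'C(a + b, a - j) * 'C(b + j, j).
Proof.
move=> leja.
have h1 := bin_fact (leq_addr b a); have h2 := bin_fact leja.
have h3 : a - j <= a + b by lia.
have h4 := bin_fact h3; have h5 := bin_fact (leq_addl b j).
move: h1 h2 h4 h5; rewrite addKn addnK (_ : a + b - (a - j) = b + j); last by lia.
move=> h1 h2 h4 h5.
have pos : 0 < j`! * ((a - j)`! * b`!) by rewrite !muln_gt0 !fact_gt0.
apply/eqP; rewrite -(eqn_pmul2r pos); apply/eqP.
rewrite (_ : _ * _ = 'C(a + b, a) * ('C(a, j) * (j`! * (a - j)`!) * b`!)); last by ring.
rewrite h2 h1 (_ : _ * _ * _ =
  'C(a + b, a - j) * ((a - j)`! * ('C(b + j, j) * (j`! * b`!)))); last by ring.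
by rewrite h5 h4.
Qed.

Lemma shadow_setD n k j (F : {set {set 'I_n}}) (A J : {set 'I_n}) :
  F \subset ksubsets n k -> A \in F -> J \subset A -> #|J| = j ->
  A :\: J \in shadow k j F.
Proof.
move=> /subsetP hF AF sJ cJ; have := hF A AF; rewrite !inE => /eqP cA.
rewrite cardsDS // cA cJ eqxx /=; apply/exists_inP; exists A => //.
exact: subsetDl.
Qed.

(** With [w = 2k - t], the same split is applied to the shadow: the sets [J] removed below leave
    each member in its own part, so the three shadow bounds add up. *)
Definition low n w (S : {set {set 'I_n}}) : {set {set 'I_n}} :=
  [set A : {set 'I_n} in S | A \subset init n w.-1].

Definition mid n w (S : {set {set 'I_n}}) : {set {set 'I_n}} :=
  [set A : {set 'I_n} in S | (A \subset init n w) && ~~ (A \subset init n w.-1)].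

Definition high n w (S : {set {set 'I_n}}) : {set {set 'I_n}} :=
  [set A : {set 'I_n} in S | ~~ (A \subset init n w)].

Lemma card_low_mid_high n w (S : {set {set 'I_n}}) :
  #|S| = #|low w S| + #|mid w S| + #|high w S|.
Proof. exact/card_split3/init_subset/leq_pred. Qed.

(* From here on k = u + j + d and t = j + d, which avoids the truncated
   differences u = k - t and d = t - j. *)
Section Pieces.
Variables (n u j d : nat) (F : {set {set 'I_n}}).
Hypotheses (u0 : 0 < u) (j0 : 0 < j) (d0 : 0 < d).
Let k := u + j + d.
Let t := j + d.
Let w := 2 * u + j + d.
Hypothesis hF : F \subset ksubsets n k.

Let cardF (A : {set 'I_n}) : A \in F -> #|A| = k.
Proof. by move/(subsetP hF); rewrite inE => /eqP. Qed.

Lemma low_lym : #|low w F| * 'C(k, j) <= #|low w (shadow k j F)| * 'C(u.-1 + j, j).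
Proof.
have -> : u.-1 = w.-1 - k by rewrite /w /k; lia.
apply: (@local_lym _ (low w F) (low w (shadow k j F)) (init n w.-1)).
- exact: card_init.
- by rewrite /k; lia.
- by move=> A; rewrite inE => /andP[AF /setIidPl ->]; rewrite cardF.
move=> A J; rewrite inE => /andP[AF sA] sJ cJ.
rewrite inE (shadow_setD hF) ?(subset_trans sJ (subsetIl _ _)) //=.
exact: subset_trans (subsetDl _ _) sA.
Qed.

(** [J] is taken inside [init w.-1], so that [A :\: J] keeps the last point of [init w]. The cost is
    [u + j] in place of [u.-1 + j]: this part falls short of the target ratio, while [low] exceeds
    it. *)
Lemma mid_lym : #|mid w F| * 'C(k.-1, j) <= #|mid w (shadow k j F)| * 'C(u + j, j).
Proof.
have ew : w = w.-1.+1 by rewrite /w; lia.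
have -> : u = w.-1 - k.-1 by rewrite /w /k; lia.
apply: (@local_lym _ (mid w F) (mid w (shadow k j F)) (init n w.-1)).
- exact: card_init.
- by rewrite /k; lia.
- move=> A; rewrite inE => /and3P[AF /setIidPl sA _].
  by move: (card_setI_initS A w.-1); rewrite -ew sA cardF //; lia.
move=> A J; rewrite inE => /and3P[AF sA nA] sJ cJ.
rewrite inE (shadow_setD hF) ?(subset_trans sJ (subsetIl _ _)) //=.
rewrite (subset_trans (subsetDl _ _) sA) /=; apply: contra nA => sD.
rewrite -(setID A J) subUset sD andbT.
by apply: subset_trans (subset_trans (subsetIr _ _) sJ) (subsetIr _ _).
Qed.

(** Raising [c] lowers [L] and so improves the ratio; [2 * L + c <= w] keeps [J] inside [init w]. *)
Lemma high_lym c L : j <= c -> 2 * L + c <= w -> L + c = k.-1 ->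
  (forall A : {set 'I_n}, A \in high w F ->
     exists2 i, i <= L & i + c <= #|A :&: init n (2 * i + c)|) ->
  #|high w F| * 'C(k.-1, j) <= #|high w (shadow k j F)| * 'C(L + j, j).
Proof.
move=> jc Lw eL hits; rewrite -eL.
apply: line_lym => // A J; rewrite inE => /andP[AF nA] sJ cJ.
rewrite inE (shadow_setD hF) ?(subset_trans sJ (subsetIl _ _)) //=.
apply: contra nA => sD; rewrite -(setID A J) subUset sD andbT.
apply: subset_trans (subset_trans (subsetIr _ _) sJ) _.
exact: subset_trans (subsetIr _ _) (init_subset _ Lw).
Qed.

Lemma card_low : #|low w F| <= 'C(w.-1, k).
Proof.
apply: leq_trans (leq_bin2l k (card_init n w.-1)); rewrite -cards_draws.
apply/subset_leq_card/subsetP => A; rewrite !inE => /andP[AF ->].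
by rewrite cardF // eqxx.
Qed.

Variable last : 'I_n.
Hypothesis ew : w = last.+1.

Lemma mid_mem (A : {set 'I_n}) : A \in mid w F -> last \in A /\ A :\ last \subset init n w.-1.
Proof.
rewrite inE => /and3P[AF sA nA]; rewrite {1}ew initS in sA.
have lastA : last \in A.
  apply: contraNT nA => lA; apply/subsetP => z zA.
  move: (subsetP sA z zA); rewrite in_setU1 ew => /orP[/eqP e|//].
  by rewrite -e zA in lA.
split=> //; apply/subsetP => z; rewrite in_setD1 => /andP[zl /(subsetP sA)].
by rewrite in_setU1 (negPf zl) ew.
Qed.

(** Deleting [last] maps [mid w F] injectively to [(k - 1)]-subsets of [init w.-1], none of which
    lies in [M]. *)
Lemma card_mid (M : {set {set 'I_n}}) :
  (forall P : {set 'I_n}, P \in M ->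
     [/\ P \subset init n w.-1, #|P| = k.-1 & last |: P \notin F]) ->
  #|mid w F| + #|M| <= 'C(w.-1, k.-1).
Proof.
move=> hM; rewrite -{1}(card_in_imset (f := fun A => A :\ last) (D := mid w F)); last first.
  move=> A B /mid_mem[lA _] /mid_mem[lB _] e.
  by rewrite -(setD1K lA) e setD1K.
rewrite -(cardsUI _ M) (_ : _ :&: M = set0) ?cards0 ?addn0; last first.
  apply/setP => P; rewrite !inE; apply/negP => /andP[/imsetP[A Amid ->] /hM [_ _]].
  have [lA _] := mid_mem Amid; rewrite setD1K //.
  by move: Amid; rewrite inE => /andP[->].
apply: leq_trans (leq_bin2l k.-1 (card_init n w.-1)); rewrite -cards_draws.
apply/subset_leq_card/subsetP => P; rewrite !inE => /orP[/imsetP[A Amid ->]|].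
  have [lA ->] := mid_mem Amid.
  have AF : A \in F by move: Amid; rewrite inE => /andP[].
  have := cardsD1 last A; rewrite lA (cardF AF).
  by move=> ->; rewrite add1n eqxx.
by move/hM => [-> -> _]; rewrite eqxx.
Qed.

End Pieces.

Lemma card_not_hits n h m a b : m <= n -> a + b = m + h -> a <= b ->
  'C(m, a) <= 'C(m, b) +
    #|[set P : {set 'I_n} | [&& P \subset init n m, #|P| == a & ~~ hits h m P]]|.
Proof.
move=> lemn eab leab; rewrite -{1}(card_init_eq lemn) -cards_draws.
rewrite -(cardsID [set P | hits h m P]); apply: leq_add.
  apply: leq_trans (card_hits lemn eab leab); apply/subset_leq_card/subsetP => P.
  by rewrite !inE -andbA.
by apply/subset_leq_card/subsetP => P; rewrite !inE andbC -andbA.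
Qed.

(** The path has height at least [c] at some time [2 * i + c] before [2 * L + c]. The pairs
    [(t, u)], [(t.+1, u.-1)], [(t.+2, u.-2)] used for [(c, L)] give the time limits [w], [w.-1],
    [w.-2]. *)
Definition meets_line n c L (A : {set 'I_n}) :=
  [exists i : 'I_L, i + c <= #|A :&: init n (2 * i + c)|].

Lemma not_meets_line n c L (A : {set 'I_n}) : 0 < c -> ~~ meets_line c L A ->
  forall N, N < 2 * L + c -> 2 * #|A :&: init n N| < N + c.
Proof.
move=> c0 /existsPn h; apply: prefix_bound => // i ltiL.
by rewrite ltnNge; apply: (h (Ordinal ltiL)).
Qed.

Lemma meets_lineP n c L (A : {set 'I_n}) : meets_line c L A ->
  0 < L /\ exists2 i, i <= L.-1 & i + c <= #|A :&: init n (2 * i + c)|.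
Proof. by case/existsP => i hi; split; [| exists i => //]; have := ltn_ord i; lia. Qed.

(** * Consequences of shiftedness for the three parts *)

Section Main.
Variables (n u j d : nat) (F : {set {set 'I_n}}).
Hypotheses (u0 : 0 < u) (j0 : 0 < j) (d0 : 0 < d).
Let k := u + j + d.
Let t := j + d.
Let w := 2 * u + j + d.
Hypotheses (hF : F \subset ksubsets n k) (ht : t_intersecting t F) (hs : shifted F).

Let cardF (A : {set 'I_n}) : A \in F -> #|A| = k.
Proof. by move/(subsetP hF); rewrite inE => /eqP. Qed.

Let prefix_le (A : {set 'I_n}) N : A \in F -> #|A :&: init n N| <= k.
Proof. by move/cardF => <-; apply: subset_leq_card (subsetIl _ _). Qed.

Let high_prefix (A : {set 'I_n}) N : A \in high w F -> N <= w -> #|A :&: init n N| < k.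
Proof.
rewrite inE => /andP[AF nA] leN; rewrite -(cardF AF); apply: proper_card.
rewrite properE subsetIl /=; apply: contra nA => sA.
exact: subset_trans sA (subset_trans (subsetIr _ _) (init_subset _ leN)).
Qed.

Lemma meets_all : (forall A, A \in F -> meets_line t u A) ->
  #|F| * 'C(k.-1, j) <= #|shadow k j F| * 'C(u.-1 + j, j).
Proof.
move=> h; have -> : k.-1 = u.-1 + t by rewrite /k /t; lia.
apply: line_lym => [|A AF|A J AF sJ cJ]; first by rewrite /t; lia.
  by case: (meets_lineP (h A AF)).
exact: shadow_setD hF AF (subset_trans sJ (subsetIl _ _)) cJ.
Qed.

(** At some time [N] the heights of [A] and [A0] add up to at least [2 * t]. If [A] missed the line,
    they would be at most [t] and [t - 1] before time [w.-1]; later times are excluded because [A]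
    has at most [k] points, and fewer up to time [w]. *)
Lemma high_meets (A0 A : {set 'I_n}) : A0 \in F -> ~~ meets_line t u A0 -> A \in high w F ->
  meets_line t.+1 u.-1 A.
Proof.
move=> A0F hA0 Ah; apply: contraT => hA; exfalso.
have AF : A \in F by move: Ah; rewrite inE => /andP[].
have [N hN] := shifted_intersecting_prefix ht hs AF A0F.
have b0 := @not_meets_line n t u A0 _ hA0 N.
have b1 := @not_meets_line n t.+1 u.-1 A _ hA N.
have c0 := prefix_le N A0F; have c1 := prefix_le N AF.
have c2 := @high_prefix A N Ah.
move: b0 b1 c2 c0 c1 hN; rewrite /k /t /w.
move: #|A :&: _| #|A0 :&: _| => x y b0 b1 c2 c0 c1 hN.
have [ltN|leN] := ltnP N (2 * u + j + d).
  have {}b0 : 2 * y < N + (j + d) by apply: b0; lia.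
  have {}c2 : x < u + j + d by apply: c2; lia.
  have [ltN'|leN'] := ltnP N (2 * u + j + d).-1; last lia.
  have {}b1 : 2 * x < N + (j + d).+1 by apply: b1; lia.
  lia.
have [eN|ltN] := eqVneq N (2 * u + j + d); last lia.
have {}c2 : x < u + j + d by apply: c2; lia.
lia.
Qed.

Lemma card_mid_gain (A : {set 'I_n}) : w < n -> 1 < u -> A \in high w F -> ~~ meets_line t.+2 u.-2 A ->
  #|mid w F| + 'C(w.-2, k.-2) <= 'C(w.-1, k.-1) + 'C(w.-2, k.-1).
Proof.
move=> wn u1 Ah hA.
have last_lt : w.-1 < n by lia.
have last2_lt : w.-2 < n by lia.
pose last := Ordinal last_lt; pose last2 := Ordinal last2_lt.
have AF : A \in F by move: Ah; rewrite inE => /andP[].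
pose Z := [set P : {set 'I_n} |
  [&& P \subset init n w.-2, #|P| == k.-2 & ~~ hits t.-1 w.-2 P]].
(* Reflection at height [t.-1] exchanges [k.-2] and [k.-1] up-steps, as their sum is
   [w.-2 + t.-1]. *)
have hZ : 'C(w.-2, k.-2) <= 'C(w.-2, k.-1) + #|Z|.
  by apply: card_not_hits; rewrite /w /k /t; lia.
have Zl (P : {set 'I_n}) : P \in Z -> last2 \notin P.
  rewrite inE => /and3P[/subsetP sP _ _]; apply/negP => /sP.
  by rewrite inE ltnn.
pose M := [set last2 |: P | P in Z].
have cM : #|M| = #|Z|.
  apply: card_in_imset => P Q /Zl hP /Zl hQ e.
  by rewrite -(setU1K hP) e setU1K.
have e1 : w.-1 = last2.+1 by rewrite /= /w; lia.
have e2 : w = last.+1 by rewrite /= /w; lia.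
suff h : #|mid w F| + #|M| <= 'C(w.-1, k.-1) by rewrite cM in h; lia.
apply: (card_mid hF e2) => _ /imsetP[P PZ ->].
have lP := Zl P PZ; move: PZ; rewrite inE => /and3P[sP /eqP cP hP].
split.
- rewrite -/w e1 initS; apply: setUS; exact: sP.
- by rewrite cardsU1 lP cP /k; lia.
apply/negP => BF; set B := last |: _ in BF.
have [N hN] := shifted_intersecting_prefix ht hs AF BF.
have b1 := @not_meets_line n t.+2 u.-2 A _ hA N.
have c0 := prefix_le N BF; have c1 := prefix_le N AF.
have c2 := @high_prefix A N Ah.
have PI : B :&: init n w.-2 = P.
  apply/setP => z; rewrite !inE.
  have [zP|zP] := boolP (z \in P).
    by have := subsetP sP z zP; rewrite inE => ->; rewrite !orbT.
  case: eqP => [->|_] /=; first by rewrite ltnNge; apply/negbTE; rewrite negbK /=; lia.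
  by case: eqP => [->|_] /=; rewrite ?ltnn.
have b0 : N <= w.-2 -> 2 * #|B :&: init n N| < N + t.-1.
  move=> leN; rewrite -ltnS in leN; move/existsPn/(_ (Ordinal leN)): hP.
  rewrite /= -ltnNge -PI -setIA (_ : init n w.-2 :&: init n N = init n N) //.
  by apply/setIidPr/init_subset.
have d0' : N = w.-1 -> #|B :&: init n N| <= k.-1.
  move=> ->; rewrite e1; have h := card_setI_initS B last2.
  apply: leq_trans h _; rewrite (_ : init n last2 = init n w.-2) // PI cP /k.
  by clear - u1; lia.
move: b0 b1 c2 c0 c1 hN d0'; rewrite /k /t /w; clear - u1 j0 d0.
(* Before time [w.-2] the heights are at most [t + 1] and [t - 2], too small for a sum of [2 * t].
   The times [w.-2], [w.-1], [w] and beyond are excluded by cardinality. *)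
move: #|A :&: _| #|B :&: _| => x y b0 b1 c2 c0 c1 hN d0'.
have [ltN|leN] := ltnP N (2 * u + j + d); last first.
  have [eN|ltN] := eqVneq N (2 * u + j + d); last lia.
  have {}c2 : x < u + j + d by apply: c2; lia.
  lia.
have {}c2 : x < u + j + d by apply: c2; lia.
have [eN|neN] := eqVneq N (2 * u + j + d).-1; first by have := d0' eN; lia.
have {}b0 : 2 * y < N + (j + d).-1 by apply: b0; lia.
have [eN|neN'] := eqVneq N (2 * u + j + d).-2; first lia.
have {}b1 : 2 * x < N + (j + d).+2 by apply: b1; lia.
lia.
Qed.

End Main.

(** * Arithmetic of surplus and deficit *)

Local Open Scope ring_scope.

(* p, q, b are the sizes of the three parts low, mid, high of F, C = C(w, k), M is
   the number of sets known to be missing from mid, and s = 1 or 2 according to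
   whether all sets of high reach height t + s. *)
Lemma weighted_surplus (K : realFieldType) (u j d s C M p q b : K) :
  let k := u + j + d in let w := 2 * u + j + d in
  1 < u -> 1 <= j -> 1 <= d -> 1 <= s ->
  p <= C * u / w -> q <= C * k / w - M ->
  C * (1 + d / (u + j + 2 * d + 1)) <= p + q + b ->
  0 <= C * (s * d / ((u + j + 2 * d + 1) * (u - 1)) - d / ((u + d) * (u + j)))
       + M * ((u + j)^-1 + s / (u - 1)) ->
  0 <= p / (u + d) - q / (u + j) + s * b / (u - 1).
Proof.
move=> k w u1 j1 d1 s1 hp hq hb h.
have hu : 0 < u - 1 by lra.
have hud : 0 < u + d by lra.
have huj : 0 < u + j by lra.
have hw : 0 < w by rewrite /w; lra.
have hx : 0 < u + j + 2 * d + 1 by lra.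
(* Bounding [b] from below by [hb] leaves nonpositive coefficients on [p] and [q]; at their upper
   bounds the value is exactly the quantity in [h]. *)
have a0 : 0 <= s / (u - 1) - (u + d)^-1.
  have -> : s / (u - 1) - (u + d)^-1 = (s * (u + d) - (u - 1)) / ((u - 1) * (u + d)).
    by field; rewrite !gt_eqF.
  by apply: divr_ge0; nra.
have b0 : 0 <= (u + j)^-1 + s / (u - 1).
  by apply: addr_ge0; rewrite ?invr_ge0 ?divr_ge0 ?ltW //; lra.
have c0 : 0 <= s / (u - 1) by rewrite divr_ge0 ?ltW //; lra.
have t1 := mulr_ge0 a0 (_ : 0 <= C * u / w - p).
have t2 := mulr_ge0 b0 (_ : 0 <= C * k / w - M - q).
have t3 := mulr_ge0 c0 (_ : 0 <= p + q + b - C * (1 + d / (u + j + 2 * d + 1))).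
rewrite !subr_ge0 in t1 t2 t3.
move: (addr_ge0 (addr_ge0 (t1 hp) (t2 hq)) (addr_ge0 (t3 hb) h)).
congr (0 <= _); rewrite /k /w; field.
by rewrite !gt_eqF //; move: hw; rewrite /w.
Qed.

Lemma surplus_line2 (K : realFieldType) (u j d : K) :
  1 < u -> 1 <= j -> 1 <= d ->
  0 <= 2 * d / ((u + j + 2 * d + 1) * (u - 1)) - d / ((u + d) * (u + j)).
Proof.
move=> u1 j1 d1.
have hu : 0 < u - 1 by lra.
have -> : 2 * d / ((u + j + 2 * d + 1) * (u - 1)) - d / ((u + d) * (u + j)) =
  d * (2 * ((u + d) * (u + j)) - (u + j + 2 * d + 1) * (u - 1)) /
    ((u + j + 2 * d + 1) * (u - 1) * ((u + d) * (u + j))).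
  by field; rewrite !gt_eqF //; lra.
apply: divr_ge0; first by apply: mulr_ge0; nra.
by rewrite !mulr_ge0 //; lra.
Qed.

(** The last hypothesis of [weighted_surplus] for [s = 1], divided by [C]; the factor with
    [j + d - 1] is the share of missing sets computed in [natr_bin_gain]. *)
Lemma surplus_line1 (K : realFieldType) (u j d : K) :
  let k := u + j + d in let w := 2 * u + j + d in
  1 < u -> 1 <= j -> 1 <= d ->
  0 <= d / ((u + j + 2 * d + 1) * (u - 1)) - d / ((u + d) * (u + j)) +
       k * (j + d - 1) / (w * (w - 1)) * ((u + j)^-1 + (u - 1)^-1).
Proof.
move=> k w u1 j1 d1.
have hu : 0 < u - 1 by lra.
have hud : 0 < u + d by lra.
have huj : 0 < u + j by lra.
have hx : 0 < u + j + 2 * d + 1 by lra.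
have hw : 0 < w by rewrite /w; lra.
have hw1 : 0 < w - 1 by rewrite /w; lra.
(* This uses [w <= 2 * k] and [d <= j + d - 1]. *)
have hmu : d / (2 * (w - 1)) <= k * (j + d - 1) / (w * (w - 1)).
  rewrite ler_pdivrMr ?mulr_gt0 //.
  have -> : k * (j + d - 1) / (w * (w - 1)) * (2 * (w - 1)) = 2 * k * (j + d - 1) / w.
    by field; rewrite !gt_eqF.
  by rewrite ler_pdivlMr // (mulrC d); apply: ler_pM; rewrite /w /k; lra.
have hs : 0 <= (u + j)^-1 + (u - 1)^-1 by rewrite addr_ge0 ?invr_ge0 ?ltW.
have := ler_wpM2r hs hmu; set X := _ * _ => hX.
apply: (@le_trans _ _ (d / ((u + j + 2 * d + 1) * (u - 1)) - d / ((u + d) * (u + j)) +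
  d / (2 * (w - 1)) * ((u + j)^-1 + (u - 1)^-1))); last by rewrite lerD2l.
have -> : d / ((u + j + 2 * d + 1) * (u - 1)) - d / ((u + d) * (u + j)) +
  d / (2 * (w - 1)) * ((u + j)^-1 + (u - 1)^-1) =
  d * (2 * (w - 1) * (d * j + j + 2 * d + 1) +
       ((2 * u + j - 1) * (u + j + 2 * d + 1) * (u + d) - 2 * (w - 1) * (d * u))) /
  (2 * (w - 1) * ((u + j + 2 * d + 1) * (u - 1) * ((u + d) * (u + j)))).
  by field; rewrite !gt_eqF.
apply: divr_ge0; last by rewrite !mulr_ge0 // ltW.
apply: mulr_ge0; first by lra.
apply: addr_ge0; first by rewrite !mulr_ge0 ?ltW //; nra.
have h1 : d * (w - 1) <= (u + j + 2 * d + 1) * (u + d) by rewrite /w; nra.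
have h2 : 2 * u * (d * (w - 1)) <=
    (2 * u + j - 1) * ((u + j + 2 * d + 1) * (u + d)).
  by apply: ler_pM => //; [lra | rewrite mulr_ge0 ?ltW //; lra | lra].
by rewrite subr_ge0; move: h2; congr (_ <= _); ring.
Qed.

(** Relative to the target ratio [G / R], the factors of the parts are [1 + j / (u + d)],
    [1 - j / (u + j)] and [1 + s * j / (u - 1)], so the total excess is [G * j] times the last
    hypothesis. *)
Lemma surplus_ratio (K : realFieldType) (u j d s p q b G R gp gq gb : K) :
  1 < u -> 0 < j -> 0 < d -> 0 <= G ->
  p * G * (u + j + d) / (u + d) <= gp * R ->
  q * G * u / (u + j) <= gq * R ->
  b * G * (1 + s * j / (u - 1)) <= gb * R ->
  0 <= p / (u + d) - q / (u + j) + s * b / (u - 1) ->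
  (p + q + b) * G <= (gp + gq + gb) * R.
Proof.
move=> u1 j0 d0 G0 h1 h2 h3 h.
have hu : 0 < u - 1 by lra.
have hud : 0 < u + d by lra.
have huj : 0 < u + j by lra.
have := mulr_ge0 (mulr_ge0 G0 (ltW j0)) h.
have -> : G * j * (p / (u + d) - q / (u + j) + s * b / (u - 1)) =
  p * G * (u + j + d) / (u + d) + q * G * u / (u + j) +
  b * G * (1 + s * j / (u - 1)) - (p + q + b) * G.
  by field; rewrite !gt_eqF.
by lra.
Qed.

Lemma natr_bin_down (K : realFieldType) a b c a' : (a'.+1 = a)%N ->
  (a - b = c)%N -> (0 < c)%N -> 'C(a', b)%:R = 'C(a, b)%:R * c%:R / a%:R :> K.
Proof.
move=> <- <- c0; have := mul_bin_down a'.+1 b; rewrite /= => e.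
by apply: (canRL (mulfK _)); rewrite ?pnatr_eq0 // -!natrM mulnC e mulnC.
Qed.

Lemma natr_bin_diag (K : realFieldType) a b a' b' : (a'.+1 = a)%N ->
  (b'.+1 = b)%N -> 'C(a', b')%:R = 'C(a, b)%:R * b%:R / a%:R :> K.
Proof.
move=> <- <-; have := mul_bin_diag a'.+1 b'; rewrite /= => e.
by apply: (canRL (mulfK _)); rewrite ?pnatr_eq0 // -!natrM mulnC e mulnC.
Qed.

Lemma natr_pred (K : realFieldType) a : (0 < a)%N -> a.-1%:R = a%:R - 1 :> K.
Proof. by move=> a0; rewrite -[in RHS](prednK a0) -natr1 addrK. Qed.

Lemma natr_bin_low (K : realFieldType) u j d : (0 < u)%N ->
  'C((u + j + d).-1, j)%:R =
    'C(u + j + d, j)%:R * (u%:R + d%:R) / (u%:R + j%:R + d%:R) :> K.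
Proof. by move=> u0; rewrite -!natrD; apply: natr_bin_down; lia. Qed.

Lemma natr_bin_up (K : realFieldType) u j : (0 < u)%N ->
  'C(u.-1 + j, j)%:R = 'C(u + j, j)%:R * u%:R / (u%:R + j%:R) :> K.
Proof. by move=> u0; rewrite -!natrD; apply: natr_bin_down; lia. Qed.

Lemma natr_width (K : realFieldType) u j d :
  (2 * u + j + d)%:R = 2 * u%:R + j%:R + d%:R :> K.
Proof. by rewrite natrD natrD natrM. Qed.

Lemma natr_bin_width (K : realFieldType) u j d : (0 < u)%N ->
  'C((2 * u + j + d).-1, u + j + d)%:R =
    'C(2 * u + j + d, u + j + d)%:R * u%:R / (2 * u%:R + j%:R + d%:R) :> K.
Proof. by move=> u0; rewrite -natr_width; apply: natr_bin_down; lia. Qed.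

Lemma natr_bin_width_diag (K : realFieldType) u j d : (0 < u)%N ->
  'C((2 * u + j + d).-1, (u + j + d).-1)%:R =
    'C(2 * u + j + d, u + j + d)%:R * (u%:R + j%:R + d%:R) /
      (2 * u%:R + j%:R + d%:R) :> K.
Proof. by move=> u0; rewrite -natr_width -!natrD; apply: natr_bin_diag; lia. Qed.

Lemma natr_bin_gain (K : realFieldType) u j d :
  let w := 2 * u%:R + j%:R + d%:R in let k := u%:R + j%:R + d%:R in
  (1 < u)%N -> (0 < d)%N ->
  'C((2 * u + j + d).-2, (u + j + d).-2)%:R -
  'C((2 * u + j + d).-2, (u + j + d).-1)%:R =
    'C(2 * u + j + d, u + j + d)%:R * (k * (j%:R + d%:R - 1) / (w * (w - 1))) :> K.
Proof.
move=> w k u1 d0.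
have wE : (2 * u + j + d).-1%:R = w - 1 :> K.
  by rewrite natr_pred ?natr_width //; clear - d0; lia.
have kE : (u + j + d).-1%:R = k - 1 :> K.
  by rewrite natr_pred ?natrD //; clear - u1; lia.
rewrite (@natr_bin_diag K (2 * u + j + d).-1 (u + j + d).-1 _ (u + j + d).-2);
  [|clear - u1; lia..].
rewrite (@natr_bin_down K (2 * u + j + d).-1 (u + j + d).-1 u
  (2 * u + j + d).-2); [|clear - u1; lia..].
rewrite natr_bin_width_diag ?(ltnW u1) //.
rewrite wE kE -/w -/k; have u1' : 1 < u%:R :> K by rewrite ltr1n.
have d0' : 0 <= d%:R :> K by rewrite ler0n.
have j0' : 0 <= j%:R :> K by rewrite ler0n.
by rewrite /w /k; field; rewrite !gt_eqF //; lra.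
Qed.

(** * Assembling the bound *)

Lemma shadow_ge_of_high n u j d (F : {set {set 'I_n}}) (s M : rat) :
  let w := (2 * u + j + d)%N in let k := (u + j + d)%N in
  (1 < u)%N -> (0 < j)%N -> (0 < d)%N -> F \subset ksubsets n k ->
  'C(w, k)%:R * (1 + d%:R / (u%:R + j%:R + 2 * d%:R + 1)) <= #|F|%:R :> rat ->
  1 <= s -> #|mid w F|%:R <= 'C(w.-1, k.-1)%:R - M ->
  #|high w F|%:R * 'C(k.-1, j)%:R * (1 + s * j%:R / (u%:R - 1)) <=
    #|high w (shadow k j F)|%:R * 'C(u.-1 + j, j)%:R ->
  0 <= 'C(w, k)%:R * (s * d%:R / ((u%:R + j%:R + 2 * d%:R + 1) * (u%:R - 1)) -
           d%:R / ((u%:R + d%:R) * (u%:R + j%:R))) +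
         M * ((u%:R + j%:R)^-1 + s / (u%:R - 1)) ->
  (#|F| * 'C(k.-1, j) <= #|shadow k j F| * 'C(u.-1 + j, j))%N.
Proof.
move=> w k u1 j0 d0 hF hcard s1 hq hb hs0.
have u0 : (0 < u)%N by rewrite ltnW.
have hL := low_lym u0 j0 d0 hF; have hM := mid_lym u0 j0 d0 hF.
rewrite -(ler_nat rat) !natrM.
rewrite (card_low_mid_high w F) (card_low_mid_high w (shadow k j F)) !natrD.
have jQ : 1 <= j%:R :> rat by rewrite ler1n.
have dQ : 1 <= d%:R :> rat by rewrite ler1n.
have uQ : 1 < u%:R :> rat by rewrite ltr1n.
apply: (@surplus_ratio _ u%:R j%:R d%:R s) => //.
- by apply: lt_le_trans jQ.
- by apply: lt_le_trans dQ.
- move: hL; rewrite -(ler_nat rat) !natrM -/w -/k natr_bin_low // => hL.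
  apply: le_trans hL; rewrite -!mulrA ler_wpM2l //.
  rewrite le_eqVlt; apply/orP; left; apply/eqP; field.
  by rewrite !gt_eqF //; lra.
- move: hM; rewrite -(ler_nat rat) !natrM -/w -/k => hM.
  have c0 : 0 <= u%:R / (u%:R + j%:R) :> rat by rewrite divr_ge0 //; lra.
  by have := ler_wpM2r c0 hM; rewrite natr_bin_up // !mulrA.
apply: (@weighted_surplus _ _ _ _ s 'C(w, k)%:R M) => //.
- by rewrite -natr_bin_width // ler_nat; apply: card_low.
- by rewrite -natr_bin_width_diag.
- by rewrite (card_low_mid_high w F) !natrD in hcard.
Qed.

Lemma shifted_shadow_bound n u j d (F : {set {set 'I_n}}) :
  (0 < u)%N -> (0 < j)%N -> (0 < d)%N ->
  F \subset ksubsets n (u + j + d) -> t_intersecting (j + d) F -> shifted F ->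
  'C(2 * u + j + d, u + j + d)%:R *
    (1 + d%:R / (u%:R + j%:R + 2 * d%:R + 1)) <= #|F|%:R :> rat ->
  (#|F| * 'C((u + j + d).-1, j) <=
    #|shadow (u + j + d) j F| * 'C(u.-1 + j, j))%N.
Proof.
move=> u0 j0 d0 hF ht hs hcard.
have [/forall_inP|] := boolP [forall A in F, meets_line (j + d) u A].
  exact: meets_all.
case/forall_inPn => A0 A0F hA0.
pose w := (2 * u + j + d)%N; pose k := (u + j + d)%N.
have C0 : 0 < 'C(w, k)%:R :> rat.
  by rewrite ltr0n bin_gt0 /w /k; clear; lia.
(* Without such a set all of [F] would lie in [init w], against a threshold strictly above
   ['C(w, k)]. *)
have [A1 A1h] : exists A : {set 'I_n}, A \in high w F.
  apply/set0Pn/negP => /eqP high0.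
  have : (#|F| <= 'C(w, k))%N.
    apply: leq_trans (leq_bin2l k (card_init n w)); rewrite -cards_draws.
    apply/subset_leq_card/subsetP => A AF; rewrite inE.
    have -> : A \subset init n w.
      by apply/negPn/negP => nA; have := in_set0 A; rewrite -high0 inE AF nA.
    by have := subsetP hF A AF; rewrite inE.
  apply/negP; rewrite -ltnNge -(ltr_nat rat); apply: lt_le_trans hcard.
  have dQ : 1 <= d%:R :> rat by rewrite ler1n.
  rewrite ltr_pMr // ltrDl divr_gt0 ?ltr0n //.
  by rewrite ltr_wpDl // !addr_ge0 // mulr_ge0.
have w_lt_n : (w < n)%N.
  move: A1h; rewrite inE => /andP[_ /subsetPn[z _]].
  rewrite inE -leqNgt => lez; exact: leq_ltn_trans lez (ltn_ord z).
have high1 (A : {set 'I_n}) : A \in high w F -> meets_line (j + d).+1 u.-1 A.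
  exact: (high_meets u0 j0 d0 hF ht hs A0F hA0).
have u1 : (1 < u)%N.
  by case: (meets_lineP (high1 A1 A1h)) => + _; case: (u) => [|[]].
have jQ : 1 <= j%:R :> rat by rewrite ler1n.
have dQ : 1 <= d%:R :> rat by rewrite ler1n.
have uQ : 1 < u%:R :> rat by rewrite ltr1n.
have uE : u%:R = u.-2%:R + 2 :> rat.
  by rewrite -natrD; congr _%:R; clear - u1; lia.
have eR : 'C(u.-2 + j, j)%:R =
    'C(u.-1 + j, j)%:R * (u%:R - 1) / (u%:R - 1 + j%:R) :> rat.
  have -> : u%:R - 1 = u.-1%:R :> rat by rewrite natr_pred.
  by rewrite -natrD; apply: natr_bin_down; clear - u1; lia.
have [/forall_inP all2|] := boolP [forall A in high w F, meets_line (j + d).+2 u.-2 A].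
  have u2 : (2 < u)%N.
    by case: (meets_lineP (all2 A1 A1h)) => + _; case: (u) => [|[|[]]].
  have uQ2 : 2 < u%:R :> rat by rewrite ltr_nat.
  have eR2 : 'C(u.-2.-1 + j, j)%:R =
      'C(u.-2 + j, j)%:R * (u%:R - 2) / (u%:R - 2 + j%:R) :> rat.
    have -> : u%:R - 2 = u.-2%:R :> rat by rewrite uE addrK.
    by rewrite -natrD; apply: natr_bin_down; clear - u2; lia.
  apply: (@shadow_ge_of_high n u j d F 2 0); rewrite ?mul0r ?addr0 ?subr0 -/w -/k //.
  - have lt_last : (w.-1 < n)%N by clear - w_lt_n; lia.
    have ew : w = (Ordinal lt_last).+1 by rewrite /= /w; clear - u1; lia.
    have := card_mid hF (last := Ordinal lt_last) ew (M := set0).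
    by rewrite cards0 addn0 ler_nat; apply=> P; rewrite inE.
  - have hb : (#|high w F| * 'C(k.-1, j) <=
        #|high w (shadow k j F)| * 'C(u.-2.-1 + j, j))%N.
      apply: (high_lym hF (c := (j + d).+2)); try by clear - u2; lia.
      by move=> A /all2 /meets_lineP[].
    move: hb; rewrite -(ler_nat rat) !natrM eR2 eR => hb.
    have hu2 : 0 < u%:R - 2 :> rat by rewrite subr_gt0.
    have hu1 : 0 < u%:R - 1 :> rat by rewrite subr_gt0.
    (* [c] is the quotient of ['C(u.-1 + j, j)] by ['C(u.-2.-1 + j, j)]. *)
    pose c : rat := (u%:R - 1 + j%:R) * (u%:R - 2 + j%:R) / ((u%:R - 1) * (u%:R - 2)).
    have hc : 1 + 2 * j%:R / (u%:R - 1) <= c.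
      rewrite ler_pdivlMr ?mulr_gt0 // -subr_ge0.
      have -> : (u%:R - 1 + j%:R) * (u%:R - 2 + j%:R) -
          (1 + 2 * j%:R / (u%:R - 1)) * ((u%:R - 1) * (u%:R - 2)) =
          j%:R * (j%:R + 1) :> rat.
        by field; rewrite gt_eqF.
      by rewrite mulr_ge0 ?addr_ge0.
    have c0 : 0 <= c by apply: le_trans hc; rewrite addr_ge0 ?divr_ge0 ?mulr_ge0 ?(ltW hu1).
    apply: le_trans (ler_wpM2l _ hc) _; first by rewrite mulr_ge0.
    apply: le_trans (ler_wpM2r c0 hb) _; rewrite le_eqVlt; apply/orP; left; apply/eqP.
    by rewrite /c; field; rewrite !gt_eqF //; clear - hu1 hu2 jQ; lra.
  - by apply: mulr_ge0; [exact: ltW | exact: surplus_line2].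
case/forall_inPn => A Ah hA.
have hq := card_mid_gain u0 j0 d0 hF ht hs w_lt_n u1 Ah hA.
have hb : (#|high w F| * 'C(k.-1, j) <=
    #|high w (shadow k j F)| * 'C(u.-2 + j, j))%N.
  apply: (high_lym hF (c := (j + d).+1)); try by clear - u1; lia.
  by move=> B /high1 /meets_lineP[].
apply: (@shadow_ge_of_high n u j d F 1
  ('C(w.-2, k.-2)%:R - 'C(w.-2, k.-1)%:R)); rewrite -/w -/k //.
- by move: hq; rewrite -(ler_nat rat) !natrD -/w -/k => hq; lra.
- move: hb; rewrite -(ler_nat rat) !natrM eR => hb.
  have hu1 : 0 < u%:R - 1 :> rat by rewrite subr_gt0.
  have c0 : 0 <= 1 + 1 * j%:R / (u%:R - 1) :> rat.
    by apply: addr_ge0 => //; apply: divr_ge0; [rewrite mul1r | exact: ltW].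
  apply: le_trans (ler_wpM2r c0 hb) _; rewrite le_eqVlt; apply/orP; left; apply/eqP.
  by field; rewrite !gt_eqF //; clear - hu1 jQ; lra.
rewrite natr_bin_gain // -[X in _ + X]mulrA -mulrDr; apply: mulr_ge0; first exact: ltW.
by rewrite !mul1r; apply: surplus_line1.
Qed.

Theorem theorem1p4 (n k t j : nat) (F : {set {set 'I_n}})
    (hkn : (k < n)%N) (htk : (t < k)%N) (hjt : (j < t)%N) (hj : (1 <= j)%N)
    (hF : F \subset ksubsets n k)
    (hint : t_intersecting t F)
    (hcard : 'C(2 * k - t, k)%:R *
               (1 + (t%:R - j%:R) / (k%:R + t%:R + 1 - j%:R))
             <= #|F|%:R :> rat) :
  'C(2 * (k - 1) - t, k - 1 - j)%:R / 'C(2 * (k - 1) - t, k - 1)%:R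
    <= #|shadow k j F|%:R / #|F|%:R :> rat.
Proof.
have [u [d [u0 d0 ek et]]] : exists u d, [/\ (0 < u)%N, (0 < d)%N,
    k = (u + j + d)%N & t = (j + d)%N].
  by exists (k - t)%N, (t - j)%N; split; clear - htk hjt; lia.
subst k t.
have ew : (2 * (u + j + d) - (j + d) = 2 * u + j + d)%N by clear; lia.
have em : (2 * (u + j + d - 1) - (j + d) = (u + j + d).-1 + u.-1)%N.
  by clear - u0; lia.
have thrE : (j + d)%:R - j%:R = d%:R :> rat by rewrite natrD addrC addKr.
have denE : (u + j + d)%:R + (j + d)%:R + 1 - j%:R =
    u%:R + j%:R + 2 * d%:R + 1 :> rat by rewrite !natrD; ring.
rewrite ew thrE denE in hcard; rewrite em subn1.
(* The bound for the shifted family transfers back: the size is unchanged and the shadow is no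
   larger. *)
have [F' [hF' ht' hs' cF' cS']] := exists_shifted j hF hint.
have F0 : 0 < #|F|%:R :> rat.
  apply: lt_le_trans hcard; rewrite mulr_gt0 //.
    by rewrite ltr0n bin_gt0; clear; lia.
  by rewrite ltr_pwDl // divr_ge0 // !addr_ge0 // mulr_ge0.
have main : (#|F| * 'C((u + j + d).-1, j) <=
    #|shadow (u + j + d) j F| * 'C(u.-1 + j, j))%N.
  rewrite -cF'; apply: leq_trans (leq_mul cS' (leqnn _)).
  by apply: shifted_shadow_bound => //; rewrite cF'.
have swap_bin := @bin_subset_swap (u + j + d).-1 u.-1 j.
have lej : (j <= (u + j + d).-1)%N by clear - u0; lia.
have R0 : 0 < 'C(u.-1 + j, j)%:R :> rat by rewrite ltr0n bin_gt0 leq_addl.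
have Y0 : 0 < 'C((u + j + d).-1 + u.-1, (u + j + d).-1)%:R :> rat.
  by rewrite ltr0n bin_gt0 leq_addr.
rewrite ler_pdivrMr // mulrAC ler_pdivlMr // -(ler_pM2r R0).
rewrite mulrAC -natrM -swap_bin // natrM -mulrA -(mulrC #|F|%:R).
rewrite [leLHS]mulrC [leRHS]mulrAC ler_pM2r //.
by rewrite -!natrM ler_nat.
Qed.
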